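(* Let $D(n)$ be the largest number such that in every arrangement of $n$ lines in the plane in which no six lines are tangent to a common conic, there are $D(n)$ lines of the arrangement such that the triangles formed by triples of these lines have pairwise distinct areas. Then $n^{1/5}<D(n)$.
   Context: A triangle formed by three lines is the triangle bounded by them (three pairwise non-parallel lines; if concurrent the triangle is degenerate of area $0$). The general position hypothesis is that no six lines of the arrangement are tangent to a common (possibly degenerate) conic; in the paper's convention this in particular excludes six lines through a common point and six pairwise parallel lines.
   Formalization: The inequality is stated for n ≥ 2, since for n = 0 and n = 1 one has D(n) = n and the strict inequality n^{1/5} < D(n) fails. *)

(* Defs.v *)
From mathcomp Require Import all_boot all_order all_algebra.
From mathcomp Require Import all_classical all_reals all_analysis.

Set Implicit Arguments.
Unset Strict Implicit.
Unset Printing Implicit Defensive.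

Import Order.TTheory GRing.Theory Num.Theory.

Local Open Scope classical_set_scope.
Local Open Scope ring_scope.

(* Homogeneous coordinates: the affine point (x, y) is (x : y : 1); the row
   vector u = (a, b, c) is the line a x + b y + c z = 0. *)
Definition homog (R : realType) (p : R * R) : 'rV[R]_3 :=
  \row_(i < 3) [:: p.1; p.2; 1]`_i.

Definition incident (R : realType) (P u : 'rV[R]_3) : Prop := P *m u^T = 0.

Definition line_of (R : realType) (u : 'rV[R]_3) : set (R * R) :=
  [set p | incident (homog p) u].

(* Neither zero nor the line at infinity. *)
Definition affine_coords (R : realType) (u : 'rV[R]_3) : Prop :=
  u 0 0 != 0 \/ u 0 1 != 0.

Definition is_line (R : realType) (l : set (R * R)) : Prop :=
  exists2 u : 'rV[R]_3, affine_coords u & l = line_of u.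

(* The projective conic X Q X^T = 0.  Rank 3 is a nondegenerate conic, rank 2 a
   pair of lines (real or complex conjugate).  Rank 1, a double line, is left
   out: every line of the plane meets it with multiplicity two. *)
Definition is_conic (R : realType) (Q : 'M[R]_3) : Prop :=
  Q^T = Q /\ (2 <= \rank Q)%N.

(* [P] is the point of contact: it lies on l, and l lies in its polar.  [P] may
   be at infinity, so the asymptotes of a hyperbola are tangent to it.  For a
   rank 2 conic the tangents are the lines through the common point of its two
   components: a pencil of concurrent lines, or of parallel lines when this
   point is at infinity. *)
Definition tangent (R : realType) (Q : 'M[R]_3) (l : set (R * R)) : Prop :=
  exists u P : 'rV[R]_3,
    [/\ affine_coords u, l = line_of u, P != 0, incident P u &
        forall X : 'rV[R]_3, incident X u -> X *m Q *m P^T = 0].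

Definition line_arrangement (R : realType) (n : nat)
    (L : 'I_n -> set (R * R)) : Prop :=
  injective L /\ forall i, is_line (L i).

Definition no_six_cotangent (R : realType) (n : nat)
    (L : 'I_n -> set (R * R)) : Prop :=
  forall S : {set 'I_n}, #|S| = 6%N ->
    ~ exists2 Q : 'M[R]_3, is_conic Q & forall i, i \in S -> tangent Q (L i).

Definition area (R : realType) (p q r : R * R) : R :=
  `|(q.1 - p.1) * (r.2 - p.2) - (r.1 - p.1) * (q.2 - p.2)| / 2.

(* The three lines form a triangle, of area [a].  Two lines meet in exactly one
   point iff they are not parallel, so the singleton conditions make the lines
   pairwise non-parallel, hence distinct; concurrent lines are allowed and give
   p = q = r and a = 0. *)
Definition triangle_area (R : realType) (l1 l2 l3 : set (R * R)) (a : R) : Prop :=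
  exists p q r : R * R,
    [/\ l2 `&` l3 = [set p], l1 `&` l3 = [set q], l1 `&` l2 = [set r] &
        a = area p q r].

Definition distinct_areas (R : realType) (n : nat) (L : 'I_n -> set (R * R))
    (S : {set 'I_n}) : Prop :=
  forall (i j k i' j' k' : 'I_n) (a a' : R),
    i \in S -> j \in S -> k \in S -> i' \in S -> j' \in S -> k' \in S ->
    triangle_area (L i) (L j) (L k) a ->
    triangle_area (L i') (L j') (L k') a' ->
    [set i; j; k]%SET != [set i'; j'; k']%SET :> {set 'I_n} -> a != a'.

Definition guaranteed (R : realType) (n d : nat) : Prop :=
  forall L : 'I_n -> set (R * R),
    line_arrangement L -> no_six_cotangent L ->
    exists S : {set 'I_n}, #|S| = d /\ distinct_areas L S.

Definition is_largest (A : set nat) (d : nat) : Prop :=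
  A d /\ forall d', A d' -> (d' <= d)%N.

(* The largest guaranteed number; the default value 0 would only be taken if
   there were none. *)
Definition D (R : realType) (n : nat) : nat :=
  xget 0%N [set d | is_largest [set d' | guaranteed R n d'] d].

(* Main.v *)
Require Import Defs.
From mathcomp Require Import all_boot all_order all_algebra.
From mathcomp Require Import all_classical all_reals all_analysis.
From mathcomp Require Import zify ring lra.

(** Write a line as [u = (a, b, c)], let [[u, v]] be the determinant of the
    first two coordinates and normalise [u] so that [[u, v] > 0] orders the
    lines by slope.  Lines [a], [b], [l] bound a triangle of area
    [det(a, b, l)^2 / (2 |[a, b] [b, l] [a, l]|)].  For fixed [a], [b], a fixed
    area and a fixed sign of [[a, l] [b, l]], the line [l] is therefore tangent
    to one conic having [a] and [b] as asymptotes (the pencil through the common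
    point of [a] and [b] when the area is 0).  As [a] and [b] are tangent to it
    too, there are at most three such [l].

    Fix a triple [T].  A triple [p < q < r] of the same area is seen from its two
    pairs [p < q] and [q < r] with the third line outside the pair, so at most
    [3/2 binom(n-3, 2)] triples disjoint from [T] have the area of [T]; the
    triples meeting [T] are of lower order.  Hence a random [m]-subset contains
    at most about [m^6 / (16 n)] pairs of triples of equal area.  Removing one
    line for each pair leaves more than [n^(1/5)] lines when [m] is about
    [6/5 n^(1/5)].

    That the maximum defining [D] exists needs some arrangement in general
    position: the lines [(1, t, t^3)] with [t = 1, ..., n].  On them a dual conic
    is a polynomial in [t] of degree at most 6 without [t^5], and such a
    polynomial cannot have six distinct positive roots. *)

Set Implicit Arguments.
Unset Strict Implicit.
Unset Printing Implicit Defensive.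

Import Order.TTheory GRing.Theory Num.Theory.
Local Open Scope ring_scope.

(** * Sampling and deletion: large sets without conflicting triples *)

Section Counting.
Local Open Scope nat_scope.

Lemma ffactnD (n j k : nat) : n ^_ (j + k) = n ^_ j * (n - j) ^_ k.
Proof.
elim: k => [|k IHk]; first by rewrite addn0 ffactn0 muln1.
by rewrite addnS !ffactnSr IHk -mulnA subnDA.
Qed.

(** Both sides count the [m]-subsets of [n] points together with an ordered [j]-tuple of distinct
    points in the subset. *)
Lemma bin_sub_ffact (n m j : nat) :
  j <= m -> 'C(n - j, m - j) * n ^_ j = 'C(n, m) * m ^_ j.
Proof.
move=> jm; apply/eqP; rewrite -(eqn_pmul2r (fact_gt0 (m - j))); apply/eqP.
by rewrite mulnAC bin_ffact mulnC -ffactnD subnKC // -mulnA ffact_fact // bin_ffact.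
Qed.

(** The probability that a uniform [m]-subset contains [U], with denominators cleared. Such subsets
    arise from subsets of the complement by adding [U]. *)
Lemma card_draws_above (V : finType) (U : {set V}) (m : nat) :
  #|[set S : {set V} | (#|S| == m) && (U \subset S)]| * #|V| ^_ #|U|
    <= 'C(#|V|, m) * m ^_ #|U|.
Proof.
have [Um|mU] := leqP #|U| m; last first.
  rewrite (_ : [set _ | _] = finset.set0) ?cards0 //.
  apply/setP => S; rewrite !inE; apply/negbTE/negP => /andP[/eqP cS /subset_leq_card].
  by rewrite cS leqNgt mU.
rewrite -bin_sub_ffact // leq_mul2r; apply/orP; right.
have -> : #|V| - #|U| = #|~: U| by rewrite -(cardsC U) addKn.
rewrite -cards_draws.
apply: leq_trans (leq_imset_card (fun A => A :|: U) _).
apply/subset_leq_card/fintype.subsetP => S; rewrite inE => /andP[/eqP cS US].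
apply/imsetP; exists (S :\: U).
  rewrite inE finset.setDE finset.subsetIr /= -finset.setDE cardsD.
  by rewrite (finset.setIidPr US) cS.
apply/setP => x; rewrite !inE; case: (boolP (x \in U)) => [/(fintype.subsetP US) -> //|_].
by rewrite orbF.
Qed.

(** The pairs are ordered: for a symmetric [bad] each conflict is counted twice. *)
Definition bad_in (V : finType) (bad : rel {set V}) (S : {set V}) :
  {set {set V} * {set V}} :=
  [set p | [&& bad p.1 p.2, p.1 \subset S & p.2 \subset S]].

(** Removing a vertex of [T] kills both [(T, T')] and [(T', T)], so each lost vertex is paid for by
    two ordered pairs. *)
Lemma deletion (V : finType) (bad : rel {set V}) (S : {set V}) :
  symmetric bad -> irreflexive bad ->
  (forall T T', bad T T' -> T != finset.set0) ->
  exists2 S' : {set V}, 2 * #|S| <= 2 * #|S'| + #|bad_in bad S| &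
    (S' \subset S) /\ bad_in bad S' = finset.set0.
Proof.
move=> bs bi bn0; have [k] := ubnP #|S|; elim: k S => // k IHk S Sk.
have [E|[[T T']]] := finset.set_0Vmem (bad_in bad S).
  by exists S; [rewrite leq_addr | split].
rewrite inE /= => /and3P[bT TS T'S].
have /finset.set0Pn[v vT] := bn0 _ _ bT.
have vS : v \in S by exact: (fintype.subsetP TS).
have cS : #|S| = #|S :\ v|.+1 by rewrite (cardsD1 v) vS.
have [|S' le_S' [S'S indS']] := IHk (S :\ v); first by rewrite -ltnS -cS.
exists S'; last by split => //; apply: fintype.subset_trans S'S (finset.subsetDl _ _).
have TT' : T != T' by apply: contraTneq bT => ->; rewrite bi.
have lt2 : #|bad_in bad (S :\ v)| + 2 <= #|bad_in bad S|.
  rewrite -(_ : #|[set (T, T'); (T', T)]| = 2); last first.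
    by rewrite cards2 xpair_eqE (negbTE TT').
  rewrite -(_ : #|bad_in bad (S :\ v) :|: [set (T, T'); (T', T)]| = _ + _).
    apply/subset_leq_card/fintype.subsetP => -[A B]; rewrite !inE /= => /orP[|].
      case/and3P=> -> AS BS /=; apply/andP; split.
        exact: fintype.subset_trans AS (finset.subsetDl _ _).
      exact: fintype.subset_trans BS (finset.subsetDl _ _).
    by case/orP=> /eqP[-> ->]; rewrite ?bT ?TS ?T'S // bs bT.
  rewrite -cardsUI (_ : _ :&: _ = finset.set0) ?cards0 ?addn0 //.
  apply/setP => -[A B]; rewrite !inE /=; apply/negbTE/negP.
  case/andP=> /and3P[_ AS BS] /orP[|] /eqP[eA eB].
    by move/fintype.subsetP/(_ v): AS; rewrite eA vT !inE eqxx => /(_ isT).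
  by move/fintype.subsetP/(_ v): BS; rewrite eB vT !inE eqxx => /(_ isT).
rewrite cS mulnS addnC; apply: leq_trans (leq_add (leqnn _) lt2).
by rewrite addnA leq_add2r.
Qed.


Lemma sum_mem_card (V : finType) (A : {pred V}) : \sum_x (x \in A) = #|A|.
Proof. by rewrite -sum1_card [RHS]big_mkcond; apply: eq_bigr => x _; case: (x \in A). Qed.

Lemma sum_distinct_pairs (V : finType) (U : {set V}) :
  \sum_a \sum_b [&& a \in U, b \in U & b != a] = #|U| * #|U|.-1.
Proof.
transitivity (\sum_(a in U) #|U|.-1); last by rewrite sum_nat_const.
rewrite [RHS]big_mkcond; apply: eq_bigr => a _.
case: ifPn => aU; last by rewrite big1.
rewrite (cardsD1 a) aU /= -sum_mem_card; apply: eq_bigr => b _.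
by rewrite !inE andbC.
Qed.

(** Double counting: [p < q < r] is seen from [(p, q)] with [r] above and from [(q, r)] with [p]
    below, and each of the at most [binom(|U|, 2)] ordered pairs in the complement [U] of [T] sees
    at most three triples. As [lt] is not assumed transitive, [lt p r] is supplied as well. *)
Lemma card_disjoint_from (V : finType) (lt : rel V) (G : pred {set V}) (T : {set V}) :
  (forall a b, lt a b -> ~~ lt b a) ->
  (forall T', G T' -> exists p q r,
     [/\ T' = [set p; q; r], lt p q, lt q r & lt p r]) ->
  (forall a b, lt a b ->
     #|[set l | G [set a; b; l] &&
               (lt a l && lt b l || lt l a && lt l b)]| <= 3) ->
  4 * #|[set T' | G T' && (T' :&: T == finset.set0)]|
    <= 3 * (#|~: T| * #|~: T|.-1).
Proof.
move=> asym ord out; set U := ~: T.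
pose w p q r := [&& G [set p; q; r], p \in U, q \in U, r \in U, lt p q, lt q r & lt p r].
pose g a b := [&& a \in U, b \in U & lt a b].
have le_w : #|[set T' | G T' && (T' :&: T == finset.set0)]|
    <= \sum_p \sum_q \sum_r w p q r.
  rewrite pair_bigA (pair_bigA _ (fun (x : V * V) r => w x.1 x.2 r : nat)) /=.
  rewrite (sum_mem_card (fun x : V * V * V => w x.1.1 x.1.2 x.2)).
  apply: leq_trans (leq_imset_card (fun x : V * V * V => [set x.1.1; x.1.2; x.2]) _).
  apply/subset_leq_card/fintype.subsetP => T'; rewrite inE => /andP[GT' /eqP dT'].
  have [p [q [r [eT' pq qr pr]]]] := ord _ GT'.
  have T'U x : x \in T' -> x \in U.
    by move=> xT'; rewrite inE; apply/negP => xT; have := finset.in_set0 x; rewrite -dT' inE xT' xT.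
  apply/imsetP; exists (p, q, r) => //.
  by rewrite /in_mem /= /w -eT' GT' pq qr pr !T'U // eT' !inE eqxx ?orbT.
(* [w a b l] sees the triple from its lower pair, [w l a b] from its upper pair. *)
have sum_w : 2 * (\sum_p \sum_q \sum_r w p q r) =
    \sum_a \sum_b \sum_l (w a b l + w l a b).
  rewrite mul2n -addnn.
  under [RHS]eq_bigr do (under eq_bigr do rewrite big_split /=; rewrite big_split /=).
  rewrite big_split /=; congr (_ + _).
  by rewrite exchange_big /=; apply: eq_bigr => a _; rewrite exchange_big.
have le_g : \sum_a \sum_b \sum_l (w a b l + w l a b) <= \sum_a \sum_b 3 * g a b.
  apply: leq_sum => a _; apply: leq_sum => b _.
  case: (boolP (g a b)) => [/and3P[aU bU ab]|gN].
    apply: leq_trans (out a b ab); rewrite -sum_mem_card; apply: leq_sum => l _.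
    rewrite inE /w (_ : [set l; a; b] = [set a; b; l]); last first.
      by rewrite -finset.setUA finset.setUC.
    have := asym b l; have := asym l a.
    rewrite aU bU ab /=; case: (G _) => //=.
    by case: (l \in U); case: (lt a l); case: (lt l a); case: (lt b l);
      case: (lt l b) => //= h1 h2; (have := h1 isT) || (have := h2 isT).
  rewrite big1 // => l _; move: gN; rewrite /g /w.
  by case: (a \in U) => /=; case: (b \in U) => /=; case: (lt a b); rewrite ?andbF.
have sum_g : 2 * (\sum_a \sum_b g a b) <= #|U| * #|U|.-1.
  rewrite mul2n -addnn [X in X + _]exchange_big -big_split -sum_distinct_pairs /=.
  apply: leq_sum => a _; rewrite -big_split /=; apply: leq_sum => b _; rewrite /g.
  case: eqVneq => [->|_] /=.
    by have := asym a a; case: (lt a a) => [/(_ isT)|]; rewrite ?andbF.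
  by have := asym a b; case: (lt a b) => [/(_ isT)/negbTE ->|_]; rewrite ?andbF ?andbT //;
    case: (a \in U); case: (b \in U); case: (lt b a).
have sum3 : \sum_a \sum_b 3 * g a b = 3 * \sum_a \sum_b g a b.
  by rewrite big_distrr; apply: eq_bigr => a _; rewrite big_distrr.
rewrite sum3 -sum_w in le_g; lia.
Qed.

Lemma card3_through_pair (V : finType) (T : {set V}) (a b : V) :
  #|T| = 3 -> a \in T -> b \in T -> a != b -> exists l, T = [set a; b; l].
Proof.
move=> cT aT bT ab; have abT : [set a; b] \subset T by rewrite finset.subUset !finset.sub1set aT.
have /eqP/cards1P[l El] : #|T :\: [set a; b]| = 1.
  by rewrite cardsD (finset.setIidPr abT) cT cards2 ab.
by exists l; rewrite -El -{1}(finset.setIidPr abT) finset.setID.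
Qed.

Lemma card_through_pair (V : finType) (G : pred {set V}) (a b : V) (k : nat) :
  (forall T', G T' -> #|T'| = 3) -> a != b ->
  #|[set l | G [set a; b; l]]| <= k ->
  #|[set T' | [&& G T', a \in T' & b \in T']]| <= k.
Proof.
move=> G3 ab; apply: leq_trans.
apply: leq_trans (leq_imset_card (fun l => [set a; b; l]) _).
apply/subset_leq_card/fintype.subsetP => T'; rewrite inE => /and3P[GT' aT' bT'].
have [l eT'] := card3_through_pair (G3 _ GT') aT' bT' ab.
by apply/imsetP; exists l; rewrite // inE -eT'.
Qed.

(** A triple meeting [T] only in [v] yields two pairs [(v, p)] with [p] outside [T], and each such
    pair lies in at most [k] triples. *)
Lemma card_meeting_once (V : finType) (G : pred {set V}) (T : {set V}) (k : nat) :
  (forall T', G T' -> #|T'| = 3) ->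
  (forall a b, a != b -> #|[set l | G [set a; b; l]]| <= k) ->
  2 * #|[set T' | G T' && (#|T' :&: T| == 1)]| <= k * (#|T| * #|~: T|).
Proof.
move=> G3 codeg.
rewrite -sum1_card big_distrr /=.
apply: (@leq_trans (\sum_(T' in [set T' | G T' && (#|T' :&: T| == 1)])
   \sum_(v in T) \sum_(p in ~: T) ((v \in T') && (p \in T')))).
  apply: leq_sum => T'; rewrite inE => /andP[GT' /cards1P[v Ev]].
  have /andP[vT' vT] : (v \in T') && (v \in T) by rewrite -finset.in_setI Ev inE.
  rewrite (bigD1 v) //= vT' /= (leq_trans _ (leq_addr _ _)) //.
  have := G3 _ GT'; rewrite -(cardsID T T') Ev cards1 add1n => -[<-].
  rewrite muln1 -sum_mem_card [X in _ <= X]big_mkcond /=; apply: leq_sum => p _.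
  by rewrite !inE; case: (p \in T).
rewrite exchange_big /=.
apply: (@leq_trans (\sum_(v in T) \sum_(p in ~: T) k)); last first.
  by rewrite !sum_nat_const mulnA mulnC.
apply: leq_sum => v vT; rewrite exchange_big /=; apply: leq_sum => p; rewrite inE => pT.
have vp : v != p by apply: contraNneq pT => <-.
apply: leq_trans (card_through_pair G3 vp (codeg _ _ vp)).
rewrite -sum_mem_card [X in X <= _]big_mkcond /=; apply: leq_sum => T' _.
by rewrite !inE; case: (G T') => //=; case: (_ == 1).
Qed.

Lemma card_meeting_twice (V : finType) (G : pred {set V}) (T : {set V}) (k : nat) :
  (forall T', G T' -> #|T'| = 3) ->
  (forall a b, a != b -> #|[set l | G [set a; b; l]]| <= k) ->
  2 * #|[set T' | G T' && (#|T' :&: T| == 2)]| <= k * (#|T| * #|T|.-1).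
Proof.
move=> G3 codeg.
rewrite -sum1_card big_distrr /=.
apply: (@leq_trans (\sum_(T' in [set T' | G T' && (#|T' :&: T| == 2)])
   \sum_a \sum_b [&& a \in T' :&: T, b \in T' :&: T & b != a])).
  apply: leq_sum => T'; rewrite inE => /andP[_ /eqP c2].
  by rewrite sum_distinct_pairs c2.
rewrite exchange_big -sum_distinct_pairs big_distrr /=.
apply: leq_sum => a _; rewrite exchange_big big_distrr /=; apply: leq_sum => b _.
case: (boolP [&& _, _ & _]) => [/and3P[aT bT ba]|N].
  rewrite eq_sym in ba; rewrite muln1; apply: leq_trans (card_through_pair G3 ba (codeg _ _ ba)).
  rewrite -sum_mem_card [X in X <= _]big_mkcond /=; apply: leq_sum => T' _.
  by rewrite !inE; case: (G T') => //=; case: (_ == 2) => //=;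
    case: (a \in T'); case: (b \in T'); case: (b == a); rewrite ?andbF ?leq_b1.
rewrite big1 // => T' _; apply/eqP; rewrite eqb0; apply: contraNN N.
by rewrite !inE => /and3P[/andP[_ ->] /andP[_ ->] ->].
Qed.

(** First moment: the bound holds on average over all [m]-subsets, hence for one of them. The three
    terms come from pairs of triples with 0, 1 or 2 common elements, whose unions have 6, 5 or 4
    elements. *)
Lemma sparse_subset (V : finType) (lt : rel V) (bad : rel {set V}) (m : nat) :
  (forall a b, lt a b -> ~~ lt b a) ->
  symmetric bad -> irreflexive bad ->
  (forall T T', bad T T' -> exists p q r,
     [/\ T' = [set p; q; r], lt p q, lt q r & lt p r]) ->
  (forall T a b, lt a b ->
     #|[set l | bad T [set a; b; l] &&
               (lt a l && lt b l || lt l a && lt l b)]| <= 3) ->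
  (forall T a b, a != b -> #|[set l | bad T [set a; b; l]]| <= 6) ->
  m <= #|V| ->
  exists2 S : {set V}, #|S| = m &
    8 * (#|V| - 5) * #|bad_in bad S| <= m ^_ 6 + 12 * m ^_ 5 + 24 * m ^_ 4.
Proof.
move=> asym bs bi ord out codeg mV.
have lt_neq a b : lt a b -> a != b.
  by move=> ab; apply: contraTneq (ab) => e; rewrite {1}e; rewrite e in ab; exact: asym.
have bad3 T T' : bad T T' -> #|T'| = 3.
  move=> /ord[p [q [r [-> pq qr pr]]]].
  rewrite -finset.setUA cardsU1 cards2 !inE.
  by rewrite (negbTE (lt_neq _ _ pq)) (negbTE (lt_neq _ _ pr)) (lt_neq _ _ qr).
set n := #|V|; set M := m ^_ 6 + _ + _.
(* Bounds the number of [m]-subsets through [j] given points; rounding down loses nothing, since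
   that number is an integer. *)
pose c j := ('C(n, m) * m ^_ j) %/ n ^_ j.
pose draws := [set S : {set V} | #|S| == m].
have cM j : c j * n ^_ j <= 'C(n, m) * m ^_ j by exact: leq_trunc_div.
have cP (U : {set V}) : #|[set S : {set V} | (#|S| == m) && (U \subset S)]| <= c #|U|.
  rewrite leq_divRL ?card_draws_above // ffact_gt0; exact: max_card.
have swap : \sum_(S in draws) #|bad_in bad S| =
    \sum_T \sum_T' \sum_(S in draws) [&& bad T T', T \subset S & T' \subset S].
  rewrite pair_bigA exchange_big /=; apply: eq_bigr => S _.
  by rewrite -sum_mem_card; apply: eq_bigr => x _; rewrite inE.
(* A triple conflicts with at most [3/4 (n-3)(n-4)] disjoint triples, [9 (n-3)] meeting it once and
   [18] meeting it twice. The factor [8 * (n - 5)] clears denominators and completes the falling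
   factorials in the sum over [T]. *)
have perT T : 8 * (n - 5) *
     (\sum_T' \sum_(S in draws) [&& bad T T', T \subset S & T' \subset S])
   <= (#|T| == 3) * (6 * (n - 3) * (n - 4) * (n - 5) * c 6 + 72 * (n - 3) * (n - 4) * c 5
       + 144 * (n - 3) * c 4).
  case: eqVneq => [T3|T3]; last first.
    rewrite big1 ?muln0 // => T' _; rewrite big1 // => S _.
    by case: (boolP (bad T T')) => //=; rewrite bs => /bad3/eqP; rewrite (negbTE T3).
  have X0 := card_disjoint_from (G := bad T) T asym (ord T) (out T).
  have X1 := card_meeting_once T (bad3 T) (codeg T).
  have X2 := card_meeting_twice T (bad3 T) (codeg T).
  have nT : #|~: T| = n - 3 by rewrite -T3 /n -(cardsC T) addKn.
  rewrite nT T3 in X0 X1 X2.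
  move: X0 X1 X2; set x0 := #|_|; set x1 := #|_|; set x2 := #|_| => X0 X1 X2.
  have le_x : \sum_T' \sum_(S in draws) [&& bad T T', T \subset S & T' \subset S]
      <= x0 * c 6 + x1 * c 5 + x2 * c 4.
    rewrite /x0 /x1 /x2 -!sum_mem_card !big_distrl /= -!big_split /=.
    apply: leq_sum => T' _; rewrite !inE.
    case: (boolP (bad T T')) => [bT|_]; last by rewrite big1.
    have T'3 := bad3 _ _ bT.
    have cU : #|T :|: T'| = 6 - #|T' :&: T| by rewrite cardsU T3 T'3 finset.setIC.
    have cI : #|T' :&: T| < 3.
      rewrite ltn_neqAle -{2}T3 subset_leq_card ?finset.subsetIr // andbT.
      apply: contraTneq bT => cI; rewrite (_ : T' = T) ?bi //.
      have TI : T' :&: T = T by apply/eqP; rewrite eqEcard finset.subsetIr cI T3.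
      have T'I : T' :&: T = T' by apply/eqP; rewrite eqEcard finset.subsetIl cI T'3.
      by rewrite -TI T'I.
    have -> : \sum_(S in draws) [&& true, T \subset S & T' \subset S] =
        #|[set S : {set V} | (#|S| == m) && (T :|: T' \subset S)]|.
      rewrite -sum_mem_card big_mkcond; apply: eq_bigr => S _.
      by rewrite !inE finset.subUset; case: (_ == m).
    apply: leq_trans (cP _) _; rewrite cU -cards_eq0.
    by move: cI; case: #|_| => [|[|[|]]] //= _; rewrite ?mul1n ?mul0n ?addn0 ?add0n.
  rewrite mul1n; apply: leq_trans (leq_mul (leqnn _) le_x) _.
  have n54 : n - 5 <= n - 4 by apply: leq_sub2l.
  have n51 : n - 5 <= 1 * (n - 3) by rewrite mul1n; apply: leq_sub2l.
  rewrite !mulnDr; apply: leq_add; first apply: leq_add.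
  - rewrite mulnA leq_mul2r; apply/orP; right.
    rewrite (_ : (n - 3).-1 = n - 4) in X0; last by rewrite -subnS.
    have := leq_mul (leqnn (2 * (n - 5))) X0; lia.
  - rewrite mulnA leq_mul2r; apply/orP; right.
    have := leq_mul X1 n54; lia.
  - rewrite mulnA leq_mul2r; apply/orP; right.
    have := leq_mul X2 n51; lia.
have total : 8 * (n - 5) * (\sum_(S in draws) #|bad_in bad S|) <= 'C(n, m) * M.
  rewrite swap big_distrr /=; 
  apply: leq_trans; first by apply: leq_sum => T _; exact: perT.
  rewrite -big_distrl /= (_ : \sum_T _ = 'C(n, 3)); last first.
    by rewrite -card_draws -sum_mem_card; apply: eq_bigr => T _; rewrite inE.
  have n3 : 6 * 'C(n, 3) = n ^_ 3 by rewrite -bin_ffact mulnC.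
  have := cM 6; have := cM 5; have := cM 4.
  rewrite (ffactnSr n 5) (ffactnSr n 4) (ffactnSr n 3) -n3.
  rewrite /M; set C := 'C(n, m); set C3 := 'C(n, 3).
  move: (c 4) (c 5) (c 6) (m ^_ 4) (m ^_ 5) (m ^_ 6) (n - 3) (n - 4) (n - 5).
  by move=> c4 c5 c6 m4 m5 m6 n3' n4' n5' h4 h5 h6; lia.
apply: contrapT => noS.
have noS' S : S \in draws -> M < 8 * (n - 5) * #|bad_in bad S|.
  by rewrite inE => /eqP cS; rewrite ltnNge; apply/negP => le; apply: noS; exists S.
have : \sum_(S in draws) M.+1 <= \sum_(S in draws) 8 * (n - 5) * #|bad_in bad S|.
  by apply: leq_sum => S; exact: noS'.
rewrite -big_distrr /= sum_nat_const card_draws => /leq_trans/(_ total).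
by rewrite leq_pmul2l ?ltnn // bin_gt0.
Qed.

(* The choice [m ~ 6N/5] makes [m - m^6 / (16 N^5)] exceed [N]: indeed
   [6/5 - (6/5)^6 / 16 > 1]. *)
Lemma sample_size (N : nat) : 3 <= N -> exists m, [/\ N < m, m <= N ^ 5 &
  m ^_ 6 + 12 * m ^_ 5 + 24 * m ^_ 4 < 16 * (N ^ 5 - 5) * (m - N)].
Proof.
move=> N3; have [N5|N5] := ltnP N 5.
  exists N.+1; rewrite !ffactnSr ffactn0 !expnS expn0.
  by have [->|->] : N = 3 \/ N = 4 by lia.
have [t [r [-> r5]]] : exists t r, N = 5 * t + 5 + r /\ r < 5.
  exists (N %/ 5 - 1), (N %% 5); have := divn_eq N 5; have := ltn_pmod N (isT : 0 < 5).
  lia.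
(* This is the ceiling of [6N/5]. *)
exists (6 * t + 6 + r + (0 < r)); rewrite !ffactnSr ffactn0 !expnS expn0.
(* With the monomials known to be nonnegative, the polynomial inequality becomes linear in them. *)
have [t2 [t3 [t4 [t5 t6]]]] : 0 <= t * t /\ 0 <= t * t * t /\ 0 <= t * t * t * t /\
  0 <= t * t * t * t * t /\ 0 <= t * t * t * t * t * t by [].
by move: r5; case: r => [|[|[|[|[|]]]]] // _ /=; split; lia.
Qed.

Lemma exists_subset_card (V : finType) (S : {set V}) (k : nat) :
  k <= #|S| -> exists2 A : {set V}, A \subset S & #|A| = k.
Proof.
move=> /card_geqP[s [us <- sS]]; exists [set x in s].
  by apply/fintype.subsetP => x; rewrite inE => /sS.
by rewrite cardsE; apply/card_uniqP.
Qed.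

(** Sampling gives [m] vertices with fewer than [2 (m - N)] ordered conflicts, so deletion loses
    fewer than [m - N] of them. *)
Lemma large_independent_set (V : finType) (lt : rel V) (bad : rel {set V}) (N : nat) :
  (forall a b, lt a b -> ~~ lt b a) ->
  symmetric bad -> irreflexive bad ->
  (forall T T', bad T T' -> exists p q r,
     [/\ T' = [set p; q; r], lt p q, lt q r & lt p r]) ->
  (forall T a b, lt a b ->
     #|[set l | bad T [set a; b; l] &&
               (lt a l && lt b l || lt l a && lt l b)]| <= 3) ->
  (forall T a b, a != b -> #|[set l | bad T [set a; b; l]]| <= 6) ->
  3 <= N -> N ^ 5 <= #|V| ->
  exists2 S : {set V}, #|S| = N.+1 & bad_in bad S = finset.set0.
Proof.
move=> asym bs bi ord out codeg N3 NV.
have [m [Nm mN lt_m]] := sample_size N3.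
have [S cS le_S] := sparse_subset asym bs bi ord out codeg (leq_trans mN NV).
have [|S' le_S' [_ indS']] := @deletion _ bad S bs bi.
  move=> T T'; rewrite bs => /ord[p [q [r [-> _ _ _]]]].
  by apply/finset.set0Pn; exists p; rewrite !inE eqxx.
have NS' : N < #|S'|.
  have B_lt : #|bad_in bad S| < 2 * (m - N).
    rewrite ltnNge; apply/negP => B_ge.
    have := leq_mul (leqnn 8) (leq_mul (leq_sub2r 5 NV) B_ge).
    by move: (leq_ltn_trans le_S lt_m); rewrite -!mulnA; lia.
  move: le_S'; rewrite cS; lia.
have [A AS' cA] := exists_subset_card NS'.
exists A => //; apply/setP => -[T T']; rewrite [RHS]finset.in_set0; apply/negbTE.
have := finset.in_set0 (T, T').
rewrite -indS' !inE /= => /negbT; apply: contraNN => /and3P[-> TA T'A].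
by rewrite !(fintype.subset_trans _ AS').
Qed.

End Counting.

(** * Lines in coordinates and the area of their triangle *)

Definition dot3 (R : realType) (u v : 'rV[R]_3) : R :=
  u 0 0 * v 0 0 + u 0 1 * v 0 1 + u 0 2 * v 0 2.

Definition row3 (R : realType) (x y z : R) : 'rV[R]_3 := \row_(i < 3) [:: x; y; z]`_i.

Definition bracket (R : realType) (u v : 'rV[R]_3) : R :=
  u 0 0 * v 0 1 - u 0 1 * v 0 0.

(** The 3 by 3 determinant, expanded along the third column. *)
Definition det3 (R : realType) (u v w : 'rV[R]_3) : R :=
  u 0 2 * bracket v w + v 0 2 * bracket w u + w 0 2 * bracket u v.

Definition form_area (R : realType) (u v w : 'rV[R]_3) : R :=
  det3 u v w ^+ 2 / (2 * `|bracket u v * bracket v w * bracket u w|).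

Lemma sum3E (R : realType) (F : 'I_3 -> R) : \sum_i F i = F 0 + F 1 + F 2.
Proof.
rewrite !big_ord_recl big_ord0 addr0 addrA.
by congr (F _ + F _ + F _); apply/val_inj.
Qed.

Lemma ord3E (i : 'I_3) : [\/ i = 0, i = 1 | i = 2].
Proof.
by case: i => [[|[|[|//]]] h]; [constructor 1|constructor 2|constructor 3]; apply/val_inj.
Qed.

Lemma row3P (R : realType) (u v : 'rV[R]_3) :
  u 0 0 = v 0 0 -> u 0 1 = v 0 1 -> u 0 2 = v 0 2 -> u = v.
Proof. by move=> e0 e1 e2; apply/rowP => i; case: (ord3E i) => ->. Qed.

Lemma row3E (R : realType) (x y z : R) :
  ((row3 x y z 0 0 = x) * (row3 x y z 0 1 = y) * (row3 x y z 0 2 = z))%type.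
Proof. by rewrite !mxE. Qed.

Lemma mul_row_trE (R : realType) (P u : 'rV[R]_3) : (P *m u^T) 0 0 = dot3 P u.
Proof. by rewrite mxE sum3E !mxE. Qed.

Lemma incidentP (R : realType) (P u : 'rV[R]_3) : incident P u <-> dot3 P u = 0.
Proof.
rewrite /incident -mul_row_trE; split=> [->|e]; first by rewrite mxE.
by apply/matrixP => i j; rewrite !ord1 e mxE.
Qed.

Lemma line_ofP (R : realType) (u : 'rV[R]_3) (p : R * R) :
  line_of u p <-> p.1 * u 0 0 + p.2 * u 0 1 + u 0 2 = 0.
Proof.
by rewrite /line_of /= incidentP /dot3 (_ : homog p = row3 p.1 p.2 1) // !row3E mul1r.
Qed.

Lemma bracketC (R : realType) (u v : 'rV[R]_3) : bracket v u = - bracket u v.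
Proof. by rewrite /bracket; ring. Qed.

(** If the bracket vanishes, moving [p] by the direction [(- u 0 1, u 0 0)] of the first line stays
    on both lines. *)
Lemma bracket_neq0 (R : realType) (u v : 'rV[R]_3) (p : R * R) :
  affine_coords u -> (line_of u `&` line_of v)%classic = [set p]%classic ->
  bracket u v != 0.
Proof.
move=> au uv; apply/eqP => b0.
have [/line_ofP pu /line_ofP pv] : (line_of u `&` line_of v)%classic p by rewrite uv.
have : (line_of u `&` line_of v)%classic (p.1 - u 0 1, p.2 + u 0 0).
  split; apply/line_ofP => /=; first by rewrite -pu; ring.
  by rewrite -pv -[RHS]addr0 -b0 /bracket; ring.
rewrite uv /=; case: p {uv pu pv} => x y /= [e1 e0].
have u1 : u 0 1 = 0 by lra.
have u0 : u 0 0 = 0 by lra.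
by case: au; rewrite ?u1 ?u0 eqxx.
Qed.

(** Cramer's rule. *)
Lemma intersectionE (R : realType) (u v : 'rV[R]_3) (p : R * R) :
  bracket u v != 0 -> line_of u p -> line_of v p ->
  p = ((u 0 1 * v 0 2 - u 0 2 * v 0 1) / bracket u v,
       (u 0 2 * v 0 0 - u 0 0 * v 0 2) / bracket u v).
Proof.
move=> b0 /line_ofP pu /line_ofP pv.
case: p pu pv => x y /= pu pv.
have e1 : x * bracket u v = u 0 1 * v 0 2 - u 0 2 * v 0 1.
  apply/eqP; rewrite -subr_eq0 -(mulr0 (v 0 1)) -pu -[X in _ == X]subr0 -(mulr0 (u 0 1)) -pv.
  by apply/eqP; rewrite /bracket; ring.
have e2 : y * bracket u v = u 0 2 * v 0 0 - u 0 0 * v 0 2.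
  apply/eqP; rewrite -subr_eq0 -(mulr0 (u 0 0)) -pv -[X in _ == X]subr0 -(mulr0 (v 0 0)) -pu.
  by apply/eqP; rewrite /bracket; ring.
by rewrite -e1 -e2 !mulfK.
Qed.

(** With the vertices from [intersectionE], twice the signed area is minus the squared determinant
    over the product of the brackets. *)
Lemma triangle_areaP (R : realType) (u v w : 'rV[R]_3) (a : R) :
  affine_coords u -> affine_coords v ->
  triangle_area (line_of u) (line_of v) (line_of w) a ->
  [/\ bracket u v != 0, bracket v w != 0, bracket u w != 0 & a = form_area u v w].
Proof.
move=> au av [p [q [r [vw uw uv ->]]]].
have b1 := bracket_neq0 au uv; have b2 := bracket_neq0 av vw; have b3 := bracket_neq0 au uw.
split=> //.
have [pv pw] : (line_of v `&` line_of w)%classic p by rewrite vw.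
have [qu qw] : (line_of u `&` line_of w)%classic q by rewrite uw.
have [ru rv] : (line_of u `&` line_of v)%classic r by rewrite uv.
rewrite (intersectionE b2 pv pw) (intersectionE b3 qu qw) (intersectionE b1 ru rv).
rewrite /area /form_area /=.
set E := (X in `|X|).
have -> : E = - (det3 u v w ^+ 2 / (bracket u v * bracket v w * bracket u w)).
  rewrite /E {E} /det3; move: b1 b2 b3; rewrite /bracket => b1 b2 b3.
  by field; rewrite b1 b2 b3.
rewrite normrN normrM normfV (ger0_norm (sqr_ge0 _)) invfM; ring.
Qed.

(** * Conics with two given asymptotes *)

(** The conic [2 (a . X) (b . X) = k z^2]; for [k = 0] it degenerates to the pair of lines [a],
    [b]. *)
Definition hyperbola (R : realType) (a b : 'rV[R]_3) (k : R) : 'M[R]_3 :=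
  a^T *m b + b^T *m a - k *: delta_mx 2 2.

Lemma hyperbolaC (R : realType) (a b : 'rV[R]_3) (k : R) :
  hyperbola a b k = hyperbola b a k.
Proof. by rewrite /hyperbola [b^T *m a + _]addrC. Qed.

Lemma hyperbola_entry (R : realType) (a b : 'rV[R]_3) (k : R) (i j : 'I_3) :
  hyperbola a b k i j = a 0 i * b 0 j + b 0 i * a 0 j - k * ((i == 2) && (j == 2))%:R.
Proof. by rewrite !mxE !big_ord1 !mxE. Qed.

Lemma hyperbola_form (R : realType) (a b : 'rV[R]_3) (k : R) (X P : 'rV[R]_3) :
  (X *m hyperbola a b k *m P^T) 0 0 =
    dot3 X a * dot3 b P + dot3 X b * dot3 a P - k * X 0 2 * P 0 2.
Proof.
rewrite mxE sum3E !mxE !sum3E !hyperbola_entry /= /dot3; ring.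
Qed.

(** The upper left 2 by 2 block has determinant [- bracket a b ^+ 2], whatever [k] is. *)
Lemma hyperbola_conic (R : realType) (a b : 'rV[R]_3) (k : R) :
  bracket a b != 0 -> is_conic (hyperbola a b k).
Proof.
move=> ab; split.
  by apply/matrixP => i j; rewrite mxE !hyperbola_entry andbC; ring.
pose A : 'M[R]_(2, 3) := pid_mx 2.
have rk2 : \rank (A *m hyperbola a b k *m A^T) = 2%N.
  apply: mxrank_unit; rewrite unitmxE unitfE (expand_det_row _ 0) !big_ord_recl big_ord0.
  rewrite /cofactor !det_mx11 !mxE !sum3E !mxE !sum3E !hyperbola_entry !mxE /=.
  have : - bracket a b ^+ 2 != 0 by rewrite oppr_eq0 sqrf_eq0.
  congr (_ != 0); rewrite /bracket /=; ring.
apply: leq_trans (mxrankM_maxr A _); apply: leq_trans (mxrankM_maxl _ A^T).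
by rewrite rk2.
Qed.

(** The contact point is the point at infinity of [a]. *)
Lemma tangent_asymptote (R : realType) (a b : 'rV[R]_3) (k : R) :
  affine_coords a -> tangent (hyperbola a b k) (line_of a).
Proof.
move=> aa; exists a, (row3 (a 0 1) (- a 0 0) 0); split => //.
- apply/eqP => /rowP e; have := e 0; have := e 1; rewrite !row3E !mxE => /eqP.
  by rewrite oppr_eq0 => /eqP e0 e1; case: aa; rewrite ?e0 ?e1 eqxx.
- by apply/incidentP; rewrite /dot3 !row3E; ring.
- move=> X /incidentP Xa; apply/matrixP => i j; rewrite !ord1 hyperbola_form Xa [RHS]mxE.
  by rewrite /dot3 !row3E; ring.
Qed.

(* The contact point is the midpoint of the intersections with the asymptotes. *)
Lemma tangent_hyperbola (R : realType) (a b u : 'rV[R]_3) :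
  affine_coords u -> bracket a u != 0 -> bracket b u != 0 ->
  tangent (hyperbola a b (- det3 a b u ^+ 2 / (2 * (bracket a u * bracket b u))))
    (line_of u).
Proof.
move=> uu au bu.
pose P := row3
  ((a 0 1 * u 0 2 - a 0 2 * u 0 1) / bracket a u + (b 0 1 * u 0 2 - b 0 2 * u 0 1) / bracket b u)
  ((a 0 2 * u 0 0 - a 0 0 * u 0 2) / bracket a u + (b 0 2 * u 0 0 - b 0 0 * u 0 2) / bracket b u)
  2.
exists u, P; split => //.
- by apply/eqP => /rowP/(_ 2)/eqP; rewrite row3E mxE pnatr_eq0.
- apply/incidentP; rewrite /dot3 !row3E; move: au bu; rewrite /bracket => au bu.
  by field; rewrite au bu.
move=> X /incidentP Xu; apply/matrixP => i j; rewrite !ord1 hyperbola_form [RHS]mxE.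
have bP : dot3 b P = - det3 a b u / bracket a u.
  rewrite /dot3 !row3E /det3; move: au bu; rewrite /bracket => au bu.
  by field; rewrite au bu.
have aP : dot3 a P = det3 a b u / bracket b u.
  rewrite /dot3 !row3E /det3; move: au bu; rewrite /bracket => au bu.
  by field; rewrite au bu.
(* The combination [[b, u] a + [u, a] b + [a, b] u] equals [(0, 0, det3 a b u)]. *)
have XE : dot3 X a * bracket b u - dot3 X b * bracket a u = det3 a b u * X 0 2.
  apply/eqP; rewrite -subr_eq0 -[X in _ == X](mulr0 (- bracket a b)) -Xu.
  by apply/eqP; rewrite /det3 /dot3 /bracket; ring.
rewrite bP aP !row3E.
transitivity (- det3 a b u / (bracket a u * bracket b u) *
   (dot3 X a * bracket b u - dot3 X b * bracket a u - det3 a b u * X 0 2)).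
  by field; rewrite au bu.
by rewrite XE subrr mulr0.
Qed.

(** * The area as a function of an unordered triple *)

Lemma bracketxx (R : realType) (u : 'rV[R]_3) : bracket u u = 0.
Proof. by rewrite /bracket; ring. Qed.

Lemma form_areaC12 (R : realType) (u v w : 'rV[R]_3) : form_area v u w = form_area u v w.
Proof.
rewrite /form_area; congr (_ / (2 * _)); first by rewrite /det3 /bracket; ring.
by rewrite (bracketC u v) !mulNr normrN mulrAC.
Qed.

Lemma form_areaC23 (R : realType) (u v w : 'rV[R]_3) : form_area u w v = form_area u v w.
Proof.
rewrite /form_area; congr (_ / (2 * _)); first by rewrite /det3 /bracket; ring.
by rewrite (bracketC v w) mulrN mulNr normrN mulrC mulrA mulrAC.
Qed.

Lemma cards3_neq (V : finType) (a b c : V) :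
  #|[set a; b; c]| = 3%N -> [/\ a != b, a != c & b != c].
Proof.
rewrite -finset.setUA cardsU1 cards2 !inE.
by case: (a == b); case: (a == c); case: (b == c).
Qed.

Definition has_area (R : realType) (n : nat) (u : 'I_n -> 'rV[R]_3) (T : {set 'I_n}) (x : R) :=
  exists i j k, [/\ T = [set i; j; k], bracket (u i) (u j) != 0,
    bracket (u j) (u k) != 0, bracket (u i) (u k) != 0 & x = form_area (u i) (u j) (u k)].

Lemma has_area_card (R : realType) (n : nat) (u : 'I_n -> 'rV[R]_3) (T : {set 'I_n}) (x : R) :
  has_area u T x -> #|T| = 3%N.
Proof.
move=> [i [j [k [-> ij jk ik _]]]]; rewrite -finset.setUA cardsU1 cards2 !inE.
have neq (p q : 'I_n) : bracket (u p) (u q) != 0 -> p != q.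
  by apply: contraNneq => ->; rewrite bracketxx.
by rewrite (negbTE (neq _ _ ij)) (negbTE (neq _ _ ik)) (neq _ _ jk).
Qed.

(** Every enumeration gives the same area, because [form_area] is invariant under two transpositions
    that generate all permutations. *)
Lemma has_area_set3 (R : realType) (n : nat) (u : 'I_n -> 'rV[R]_3) (a b c : 'I_n) (x : R) :
  has_area u [set a; b; c] x ->
  [/\ bracket (u a) (u b) != 0, bracket (u b) (u c) != 0, bracket (u a) (u c) != 0 &
      x = form_area (u a) (u b) (u c)].
Proof.
move=> h; have [ab ac bc] := cards3_neq (has_area_card h).
case: h => i [j [k [E ij jk ik ->]]].
have sym p q : bracket (u p) (u q) != 0 -> bracket (u q) (u p) != 0.
  by rewrite (bracketC (u p)) oppr_eq0.
have [[ji kj] ki] := (sym _ _ ij, sym _ _ jk, sym _ _ ik).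
have : a \in [set i; j; k] by rewrite -E !inE eqxx.
have : b \in [set i; j; k] by rewrite -E !inE eqxx ?orbT.
have : c \in [set i; j; k] by rewrite -E !inE eqxx ?orbT.
have [C12 C23] := (@form_areaC12 R, @form_areaC23 R).
rewrite !inE -!orbA => /or3P[]/eqP ec /or3P[]/eqP eb /or3P[]/eqP ea; move: ab ac bc;
  rewrite ea eb ec ?eqxx // => _ _ _; split => //.
- by rewrite C23 C12 C23.
- by rewrite C12 C23.
- by rewrite C23 C12.
Qed.

Lemma has_area_inj (R : realType) (n : nat) (u : 'I_n -> 'rV[R]_3) (T : {set 'I_n}) (x y : R) :
  has_area u T x -> has_area u T y -> x = y.
Proof.
by move=> Tx [i [j [k [E _ _ _ ->]]]]; move: Tx; rewrite E => /has_area_set3[].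
Qed.

(** The condition [T != T'] makes the relation irreflexive, as the deletion argument requires. *)
Definition same_area (R : realType) (n : nat) (u : 'I_n -> 'rV[R]_3) : rel {set 'I_n} :=
  fun T T' => (T != T') && `[< exists2 x, has_area u T x & has_area u T' x >].

(** * Counting the third lines for a given pair and area *)

Lemma card_cotangent (R : realType) (n : nat) (u : 'I_n -> 'rV[R]_3) (a b : 'I_n) (k : R) :
  no_six_cotangent (fun i => line_of (u i)) -> (forall i, affine_coords (u i)) ->
  bracket (u a) (u b) != 0 ->
  (#|[set l | [&& bracket (u a) (u l) != 0, bracket (u b) (u l) != 0 &
     k == - det3 (u a) (u b) (u l) ^+ 2 /
            (2 * (bracket (u a) (u l) * bracket (u b) (u l)))]%R]| <= 3)%N.
Proof.
move=> no6 au ab; rewrite leqNgt; apply/negP => /exists_subset_card[A AS cA].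
have AP l : l \in A -> [&& bracket (u a) (u l) != 0, bracket (u b) (u l) != 0 &
     k == - det3 (u a) (u b) (u l) ^+ 2 /
            (2 * (bracket (u a) (u l) * bracket (u b) (u l)))].
  by move=> /(fintype.subsetP AS); rewrite inE.
have neq : a != b by apply: contraNneq ab => ->; rewrite bracketxx.
(* [a] and [b] violate the bracket conditions, so together with the four lines of [A] they make six
   distinct tangents. *)
have aA : a \notin A by apply/negP => /AP; rewrite bracketxx eqxx.
have bA : b \notin A by apply/negP => /AP; rewrite bracketxx eqxx andbF.
apply: (no6 (a |: (b |: A))); first by rewrite !cardsU1 cA !inE (negbTE neq) aA bA.
exists (hyperbola (u a) (u b) k); first exact: hyperbola_conic.
move=> i; rewrite !inE => /orP[/eqP ->|/orP[/eqP ->|/AP/and3P[ai bi /eqP ->]]].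
- exact: tangent_asymptote.
- by rewrite hyperbolaC; exact: tangent_asymptote.
- exact: tangent_hyperbola.
Qed.

(* The side of the pair on which the direction of the third line lies decides
   which of the two conjugate hyperbolas it touches. *)
Lemma form_area_conic (R : realType) (a b l : 'rV[R]_3) (s : bool) :
  bracket a b != 0 -> 0 < (-1) ^+ s * (bracket a l * bracket b l) ->
  - det3 a b l ^+ 2 / (2 * (bracket a l * bracket b l)) =
  - (-1) ^+ s * form_area a b l * `|bracket a b|.
Proof.
move=> ab sgn; have /eqP nz : bracket a l * bracket b l != 0.
  by apply: contraTneq sgn => ->; rewrite mulr0 ltxx.
rewrite /form_area -[bracket a b * _ * _]mulrA (mulrC (bracket b l) (bracket a l)) normrM.
have -> : `|bracket a l * bracket b l| = (-1) ^+ s * (bracket a l * bracket b l).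
  by rewrite -(gtr0_norm sgn) [RHS]normrM normrX normrN1 expr1n mul1r.
have ab' : `|bracket a b| != 0 by rewrite normr_eq0.
move: nz; case: s {sgn}; rewrite ?expr1 ?expr0;
  set d := _ * bracket b l => /eqP nz; by field; rewrite ab' nz.
Qed.

Lemma card_area_side (R : realType) (n : nat) (u : 'I_n -> 'rV[R]_3) (T : {set 'I_n})
    (a b : 'I_n) (s : bool) :
  no_six_cotangent (fun i => line_of (u i)) -> (forall i, affine_coords (u i)) ->
  (#|[set l | same_area u T [set a; b; l] &&
      (0 < (-1) ^+ s * (bracket (u a) (u l) * bracket (u b) (u l)))%R]| <= 3)%N.
Proof.
move=> no6 au; set F := [set l | _].
(* A member of [F] supplies the common area [x], which fixes the parameter of the conic. *)
have [->|[l0]] := finset.set_0Vmem F; first by rewrite cards0.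
rewrite inE => /andP[/andP[_ /asboolP[x Tx /has_area_set3[ab _ _ _]]] _].
apply: leq_trans (card_cotangent (- (-1) ^+ s * x * `|bracket (u a) (u b)|) no6 au ab).
apply/subset_leq_card/fintype.subsetP => l; rewrite !inE.
case/andP=> /andP[_ /asboolP[y Ty /has_area_set3[_ bl al ey]]] sgn.
by rewrite al bl (form_area_conic ab sgn) -ey (has_area_inj Tx Ty) eqxx.
Qed.

Lemma card_area_pair (R : realType) (n : nat) (u : 'I_n -> 'rV[R]_3) (T : {set 'I_n})
    (a b : 'I_n) :
  no_six_cotangent (fun i => line_of (u i)) -> (forall i, affine_coords (u i)) ->
  (#|[set l | same_area u T [set a; b; l]]| <= 6)%N.
Proof.
move=> no6 au.
have h s := card_area_side T a b s no6 au.
apply: leq_trans (leq_add (h false) (h true)).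
apply: leq_trans (leq_card_setU _ _).
apply/subset_leq_card/fintype.subsetP => l; rewrite !inE => sa; rewrite sa /=.
case/andP: sa => _ /asboolP[x _ /has_area_set3[_ bl al _]].
rewrite expr0 expr1 mul1r mulN1r oppr_gt0 orbC -neq_lt.
by rewrite mulf_neq0.
Qed.

(** * Ordering the lines by slope *)

Definition upper (R : realType) (u : 'rV[R]_3) : bool :=
  (0 < u 0 0) || (u 0 0 == 0) && (0 < u 0 1).

(** All terms of [u0 [v, w] + v0 [w, u] + w0 [u, v] = 0] are nonnegative, so the first coordinates
    vanish and with them the brackets. *)
Lemma upper_acyclic (R : realType) (u v w : 'rV[R]_3) :
  upper u -> upper v -> upper w ->
  0 < bracket u v -> 0 < bracket v w -> 0 < bracket w u -> False.
Proof.
have ge0 (x : 'rV[R]_3) : upper x -> 0 <= x 0 0.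
  by case/orP => [/ltW //|/andP[/eqP -> _]].
move=> /[dup] Uu /ge0 u0 /ge0 v0 /ge0 w0 uv vw wu.
have id0 : u 0 0 * bracket v w + v 0 0 * bracket w u + w 0 0 * bracket u v = 0.
  by rewrite /bracket; ring.
have u00 : u 0 0 = 0 by nra.
have v00 : v 0 0 = 0 by nra.
by move: uv; rewrite /bracket u00 v00; lra.
Qed.

Lemma upper_line (R : realType) (l : set (R * R)) : is_line l ->
  exists u : 'rV[R]_3, [/\ upper u, affine_coords u & l = line_of u].
Proof.
move=> [u au ->].
have neg : line_of u = line_of (- u).
  apply/seteqP; split => p /line_ofP e; apply/line_ofP; move: e; rewrite !mxE; lra.
have aN : affine_coords (- u) by rewrite /affine_coords !mxE !oppr_eq0.
have [U|U] := boolP (upper u); first by exists u.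
exists (- u); split => //; move: U; rewrite /upper !mxE oppr_eq0 !oppr_gt0.
case: (ltgtP (u 0 0) 0) => //= e; rewrite -leNgt => h.
by case: au; rewrite ?e ?eqxx // => h1; rewrite lt_neqAle h1.
Qed.

(** * The guaranteed number of lines *)

Lemma distinct_areas_of_independent (R : realType) (n : nat) (u : 'I_n -> 'rV[R]_3)
    (S : {set 'I_n}) :
  (forall i, affine_coords (u i)) ->
  (forall T T' : {set 'I_n}, T \subset S -> T' \subset S -> ~~ same_area u T T') ->
  distinct_areas (fun i => line_of (u i)) S.
Proof.
move=> au ind i j k i' j' k' a a' iS jS kS iS' jS' kS'.
move=> /(triangle_areaP (au i) (au j))[ij jk ik ->].
move=> /(triangle_areaP (au i') (au j'))[ij' jk' ik' ->] neq.
have sub (p q r : 'I_n) : p \in S -> q \in S -> r \in S -> [set p; q; r] \subset S.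
  by move=> pS qS rS; rewrite !finset.subUset !finset.sub1set pS qS.
apply: contraNneq (ind _ _ (sub _ _ _ iS jS kS) (sub _ _ _ iS' jS' kS')) => e.
apply/andP; split => //; apply/asboolP; exists (form_area (u i) (u j) (u k)).
  by exists i, j, k.
by exists i', j', k'; split.
Qed.

Lemma guaranteed_root (R : realType) (n N : nat) :
  (N.+1 <= n)%N -> (N ^ 5 <= n)%N -> guaranteed R n N.+1.
Proof.
move=> Nn N5n L [_ lines] no6.
have /choice[u uP] : forall i, exists u : 'rV[R]_3,
  [/\ upper u, affine_coords u & L i = line_of u] by move=> i; exact: upper_line.
have au i : affine_coords (u i) by case: (uP i).
have Uu i : upper (u i) by case: (uP i).
have eL : L = fun i => line_of (u i) by apply/funext => i; case: (uP i).
rewrite eL in no6 *.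
(* At most three lines contain at most one triple, so nothing can conflict. *)
have [N2|N3] := leqP N 2.
  have [|S _ cS] := @exists_subset_card _ [set: 'I_n]%SET N.+1.
    by rewrite cardsT card_ord.
  exists S; split=> //; apply: distinct_areas_of_independent => // T T' TS T'S.
  apply/negP => /andP[/eqP neq /asboolP[x Tx T'x]]; apply: neq.
  have eS (A : {set 'I_n}) : A \subset S -> has_area u A x -> A = S.
    by move=> AS Ax; apply/eqP; rewrite eqEcard AS cS (has_area_card Ax).
  by rewrite (eS T) // (eS T').
pose lt i j := 0 < bracket (u i) (u j).
have asym i j : lt i j -> ~~ lt j i.
  by rewrite /lt (bracketC (u i)) oppr_gt0 -leNgt => /ltW.
have total i j : bracket (u i) (u j) != 0 -> lt i j \/ lt j i.
  by rewrite /lt (bracketC (u i)) oppr_gt0 neq_lt => /orP[]; [right|left].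
have [|||||||S cS indS] := @large_independent_set _ lt (same_area u) N asym.
- move=> T T'; rewrite /same_area eq_sym; congr (_ && _).
  by apply/asboolP/asboolP => -[x]; exists x.
- by move=> T; rewrite /same_area eqxx.
- move=> T T' /andP[_ /asboolP[x _ [i [j [k [-> /total ij /total jk /total ik _]]]]]].
  have cyc p q r : lt p q -> lt q r -> lt r p -> False by exact: upper_acyclic.
  (* Two of the eight orientations are cyclic and excluded by [cyc]; each of the others sorts the
     triple. *)
  case: ij jk ik => ij [] jk [] ik.
  + by exists i, j, k.
  + by case: (cyc i j k).
  + by exists i, k, j; split=> //; apply/setP => y; rewrite !inE;
      case: (y == i); case: (y == j); case: (y == k).
  + by exists k, i, j; split=> //; apply/setP => y; rewrite !inE;
      case: (y == i); case: (y == j); case: (y == k).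
  + by exists j, i, k; split=> //; apply/setP => y; rewrite !inE;
      case: (y == i); case: (y == j); case: (y == k).
  + by exists j, k, i; split=> //; apply/setP => y; rewrite !inE;
      case: (y == i); case: (y == j); case: (y == k).
  + by case: (cyc i k j).
  + by exists k, j, i; split=> //; apply/setP => y; rewrite !inE;
      case: (y == i); case: (y == j); case: (y == k).
- move=> T a b _; apply: leq_trans (card_area_side T a b false no6 au).
  apply/subset_leq_card/fintype.subsetP => l; rewrite !inE => /andP[-> /=].
  (* With [l] beyond both or before both, the two brackets have equal signs: this is the side
     [s = false]. *)
  rewrite expr0 mul1r => /orP[] /andP[al bl]; first exact: mulr_gt0.
  by rewrite (bracketC (u l)) (bracketC (u l)) mulrNN mulr_gt0.
- by move=> T a b _; exact: card_area_pair.
- by [].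
- by rewrite card_ord.
exists S; split=> //; apply: distinct_areas_of_independent => // T T' TS T'S.
apply/negP => sTT'; have := finset.in_set0 (T, T').
by rewrite -indS inE /= sTT' TS T'S.
Qed.

(** * An arrangement in general position *)

Definition cubic_line (R : realType) (t : R) : 'rV[R]_3 := row3 1 t (t ^+ 3).

Lemma cubic_line_affine (R : realType) (t : R) : affine_coords (cubic_line t).
Proof. by left; rewrite row3E oner_neq0. Qed.

Lemma cubic_line_coords (R : realType) (t : R) (u : 'rV[R]_3) :
  line_of (cubic_line t) = line_of u ->
  u 0 1 = t * u 0 0 /\ u 0 2 = t ^+ 3 * u 0 0.
Proof.
move=> E.
have : line_of u (- t ^+ 3, 0) by rewrite -E; apply/line_ofP; rewrite !row3E /=; ring.
have : line_of u (- t ^+ 3 - t, 1) by rewrite -E; apply/line_ofP; rewrite !row3E /=; ring.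
by move=> /line_ofP /= h1 /line_ofP /= h2; split; lra.
Qed.

Definition minor (R : realType) (Q : 'M[R]_3) (i j k l : 'I_3) : R :=
  Q i k * Q j l - Q i l * Q j k.

(* The value at [(1, t, t^3)] of the dual conic [u *m \adj Q *m u^T]; the
   monomial [t^5] does not occur. *)
Definition dual_poly (R : realType) (Q : 'M[R]_3) : {poly R} :=
  Poly [:: minor Q 1 2 1 2; 2 * minor Q 1 2 2 0; minor Q 2 0 2 0;
           2 * minor Q 1 2 0 1; 2 * minor Q 2 0 0 1; 0; minor Q 0 1 0 1].

(** Here [a], ..., [f] are the entries of a symmetric [Q], [P = (p, q, r)] and [u = (1, t, t^3)];
    the last two hypotheses say [Q P = y0 u], the conclusion [u adj(Q) u = 0]. If [y0] is nonzero,
    [y0 u adj(Q) u = det(Q) (u . P) = 0]. If [y0 = 0], [adj(Q)] is a multiple of [P P^T], and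
    [u . P = 0] again. *)
Lemma dual_conic_scalar (R : realType) (a b c d e f p q r t : R) :
  [|| p != 0, q != 0 | r != 0] -> p + q * t + r * t ^+ 3 = 0 ->
  b * p + d * q + e * r = t * (a * p + b * q + c * r) ->
  c * p + e * q + f * r = t ^+ 3 * (a * p + b * q + c * r) ->
  (d * f - e ^+ 2) + 2 * (e * c - b * f) * t + (a * f - c ^+ 2) * t ^+ 2 +
  2 * (b * e - d * c) * t ^+ 3 + 2 * (b * c - a * e) * t ^+ 4 +
  (a * d - b ^+ 2) * t ^+ 6 = 0.
Proof.
move=> nz on_u y1 y2; set F := (X in X = 0).
have [y0|y0] := eqVneq (a * p + b * q + c * r) 0; last first.
  apply: (mulfI y0); rewrite mulr0.
  pose det := a * (d * f - e ^+ 2) + b * (e * c - b * f) + c * (b * e - d * c).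
  transitivity (det * (p + q * t + r * t ^+ 3)
    - ((e * c - b * f) + t * (a * f - c ^+ 2) + t ^+ 3 * (b * c - a * e)) *
      (b * p + d * q + e * r - t * (a * p + b * q + c * r))
    - ((b * e - d * c) + t * (b * c - a * e) + t ^+ 3 * (a * d - b ^+ 2)) *
      (c * p + e * q + f * r - t ^+ 3 * (a * p + b * q + c * r))).
    by rewrite /F /det; ring.
  by rewrite on_u y1 y2 !subrr !mulr0 !subr0.
rewrite y0 mulr0 in y1 y2.
case/or3P: nz => nz; apply: (mulfI (expf_neq0 2 nz)); rewrite mulr0.
- have eb : b = - (d * q + e * r) / p by apply: (mulIf nz); rewrite divfK //; lra.
  have ec : c = - (e * q + f * r) / p by apply: (mulIf nz); rewrite divfK //; lra.
  have ea : a = - (b * q + c * r) / p by apply: (mulIf nz); rewrite divfK //; lra.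
  transitivity ((d * f - e ^+ 2) * (p + q * t + r * t ^+ 3) ^+ 2); last first.
    by rewrite on_u expr0n mulr0.
  by rewrite /F ea eb ec; field.
- have eb : b = - (a * p + c * r) / q by apply: (mulIf nz); rewrite divfK //; lra.
  have ee : e = - (c * p + f * r) / q by apply: (mulIf nz); rewrite divfK //; lra.
  have ed : d = - (b * p + e * r) / q by apply: (mulIf nz); rewrite divfK //; lra.
  transitivity ((a * f - c ^+ 2) * (p + q * t + r * t ^+ 3) ^+ 2); last first.
    by rewrite on_u expr0n mulr0.
  by rewrite /F ed eb ee; field.
- have ec : c = - (a * p + b * q) / r by apply: (mulIf nz); rewrite divfK //; lra.
  have ee : e = - (b * p + d * q) / r by apply: (mulIf nz); rewrite divfK //; lra.
  have ef : f = - (c * p + e * q) / r by apply: (mulIf nz); rewrite divfK //; lra.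
  transitivity ((a * d - b ^+ 2) * (p + q * t + r * t ^+ 3) ^+ 2); last first.
    by rewrite on_u expr0n mulr0.
  by rewrite /F ef ec ee; field.
Qed.

(** Since the line lies in the polar of [P], the vector [y = Q P] is proportional to [(1, t, t^3)];
    two points of the line suffice to see this. *)
Lemma tangent_dual_root (R : realType) (Q : 'M[R]_3) (t : R) :
  Q^T = Q -> tangent Q (line_of (cubic_line t)) -> root (dual_poly Q) t.
Proof.
move=> sQ [u [P [au E P0 /incidentP Pu tan]]].
have [u1 u2] := cubic_line_coords E.
have u0 : u 0 0 != 0 by case: au => //; apply: contra => /eqP e; rewrite u1 e mulr0.
have s i j : Q j i = Q i j by rewrite -{1}sQ mxE.
pose y i := Q i 0 * P 0 0 + Q i 1 * P 0 1 + Q i 2 * P 0 2.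
have tanE X : dot3 X u = 0 -> X 0 0 * y 0 + X 0 1 * y 1 + X 0 2 * y 2 = 0.
  move=> /incidentP/tan/matrixP/(_ 0 0); rewrite mxE sum3E !mxE !sum3E /y => <-; ring.
have y1 : y 1 = t * y 0.
  have := tanE (row3 (- t) 1 0); rewrite /dot3 !row3E u1 => h.
  by apply/eqP; rewrite -subr_eq0 -h; [apply/eqP; ring | ring].
have y2 : y 2 = t ^+ 3 * y 0.
  have := tanE (row3 (- t ^+ 3) 0 1); rewrite /dot3 !row3E u2 => h.
  by apply/eqP; rewrite -subr_eq0 -h; [apply/eqP; ring | ring].
have Pt : P 0 0 + P 0 1 * t + P 0 2 * t ^+ 3 = 0.
  apply: (mulIf u0); rewrite mul0r -Pu /dot3 u1 u2; ring.
have nzP : [|| P 0 0 != 0, P 0 1 != 0 | P 0 2 != 0].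
  rewrite -!negb_and; apply: contraNN P0 => /and3P[/eqP p0 /eqP p1 /eqP p2].
  by apply/eqP/row3P; rewrite mxE.
move: y1 y2; rewrite /y (s 0 1) (s 0 2) (s 1 2) => y1 y2.
apply/rootP; rewrite /dual_poly horner_Poly /= /minor (s 0 1) (s 0 2) (s 1 2).
by rewrite -[RHS](dual_conic_scalar nzP Pt y1 y2); ring.
Qed.

(** Up to factors 2 the coefficients are all entries of the adjugate. If a diagonal entry of [Q] is
    nonzero, its row spans [Q]; if the diagonal is zero, the principal minors force [Q = 0]. *)
Lemma minors_rank_le1 (R : realType) (Q : 'M[R]_3) :
  Q^T = Q -> dual_poly Q = 0 -> (\rank Q <= 1)%N.
Proof.
move=> sQ dQ.
have s i j : Q j i = Q i j by rewrite -{1}sQ mxE.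
have coef k : (dual_poly Q)`_k = 0 by rewrite dQ coef0.
have := (coef 0, coef 1, coef 2, coef 3, coef 4, coef 6).
rewrite /dual_poly !coef_Poly /= /minor (s 0 1) (s 0 2) (s 1 2) => -[[[[[c0 c1] c2] c3] c4] c6].
clear sQ dQ coef.
have rk i : (forall j k : 'I_3, (j <= k)%N -> Q j k * Q i i = Q i j * Q i k :> R) ->
    Q i i != 0 -> (\rank Q <= 1)%N.
  move=> QE qi; have -> : Q = (Q i i)^-1 *: ((row i Q)^T *m row i Q).
    apply/matrixP => j k; rewrite !mxE big_ord1 !mxE; apply: (mulIf qi).
    rewrite mulrC [RHS]mulrC mulVKf // mulrC.
    by case: (leqP j k) => [/QE //|/ltnW/QE]; rewrite s => ->; rewrite mulrC.
  apply: leq_trans (mxrank_scale _ _) _; apply: leq_trans (mxrankM_maxr _ _) _.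
  exact: rank_leq_row.
have le3 (F : 'I_3 -> 'I_3 -> Prop) : F 0 0 -> F 0 1 -> F 0 2 -> F 1 1 -> F 1 2 -> F 2 2 ->
    forall j k : 'I_3, (j <= k)%N -> F j k.
  by move=> ? ? ? ? ? ? j k; case: (ord3E j) => ->; case: (ord3E k) => ->.
have [q0|q0] := eqVneq (Q 0 0) 0; last by apply: (rk 0 _ q0); apply: le3; lra.
have q01 : Q 0 1 = 0 by apply/eqP; rewrite -sqrf_eq0; apply/eqP; move: c6; rewrite q0; lra.
have q02 : Q 0 2 = 0 by apply/eqP; rewrite -sqrf_eq0; apply/eqP; move: c2; rewrite q0; lra.
have [q1|q1] := eqVneq (Q 1 1) 0; last first.
  by apply: (rk 1 _ q1); apply: le3; rewrite ?(s 0 1) ?q0 ?q01 ?q02; lra.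
have q12 : Q 1 2 = 0 by apply/eqP; rewrite -sqrf_eq0; apply/eqP; move: c0; rewrite q1; lra.
have [q2|q2] := eqVneq (Q 2 2) 0; last first.
  by apply: (rk 2 _ q2); apply: le3; rewrite ?(s 0 2) ?(s 1 2) ?q0 ?q01 ?q02 ?q1 ?q12; lra.
rewrite (_ : Q = 0) ?mxrank0 //; apply/matrixP => j k; rewrite mxE.
have Q0 := le3 (fun j k => Q j k = 0) q0 q01 q02 q1 q12 q2.
by case: (leqP j k) => [/Q0 //|/ltnW/Q0]; rewrite s.
Qed.

(** Otherwise [p] has degree 6 and these are all its roots, so by Vieta their positive sum would be
    zero. *)
Lemma six_positive_roots (R : realType) (p : {poly R}) (rs : seq R) :
  (size p <= 7)%N -> p`_5 = 0 -> size rs = 6%N -> uniq rs -> all (root p) rs ->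
  (forall x, x \in rs -> 0 < x) -> p = 0.
Proof.
move=> sp p5 srs urs rts pos; apply/eqP/negPn/negP => p0.
have := max_poly_roots p0 rts urs; rewrite srs => lt_p.
have sp7 : size p = (size rs).+1 by rewrite srs; apply/eqP; rewrite eqn_leq sp.
have urs' : uniq_roots rs by rewrite uniq_rootsE.
have pE := all_roots_prod_XsubC sp7 rts urs'.
have rs0 : size rs != 0%N by rewrite srs.
have := coefPn_prod_XsubC rs0; rewrite srs /= => c5.
move/(congr1 (fun q : {poly R} => q`_5)): pE; rewrite p5 coefZ c5 => /esym/eqP.
rewrite mulf_eq0 lead_coef_eq0 (negbTE p0) oppr_eq0 /=; apply/negP/lt0r_neq0.
case: rs srs pos {sp7 urs rts urs' rs0 c5} => // x rs _ pos; rewrite big_cons.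
apply: ltr_pwDl; first by apply: pos; rewrite mem_head.
rewrite big_seq; apply: sumr_ge0 => y yrs; apply/ltW/pos.
by rewrite inE yrs orbT.
Qed.

(** The shift to [i.+1] keeps all parameters positive, as [six_positive_roots] requires. *)
Definition cubic_arrangement (R : realType) (n : nat) (i : 'I_n) : set (R * R) :=
  line_of (cubic_line i.+1%:R).

Lemma cubic_arrangementP (R : realType) (n : nat) :
  line_arrangement (@cubic_arrangement R n) /\ no_six_cotangent (@cubic_arrangement R n).
Proof.
split.
  split=> [i j|i]; last by exists (cubic_line i.+1%:R) => //; exact: cubic_line_affine.
  move=> /cubic_line_coords[]; rewrite !row3E mulr1 => /eqP.
  by rewrite eqr_nat => /eqP[e] _; apply/val_inj.
move=> S S6 [Q [sQ rQ] tan].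
suff Q0 : dual_poly Q = 0 by have := minors_rank_le1 sQ Q0; rewrite leqNgt rQ.
have S6' : size (enum S) = 6%N by rewrite -cardE.
apply: (@six_positive_roots _ _ [seq i.+1%:R | i : 'I_n <- enum S]).
- exact: size_Poly.
- by rewrite coef_Poly.
- by rewrite size_map.
- rewrite map_inj_uniq ?enum_uniq // => i j /eqP; rewrite eqr_nat => /eqP[e].
  exact/val_inj.
- apply/allP => x /mapP[i]; rewrite mem_enum => iS ->.
  exact: tangent_dual_root sQ (tan i iS).
- by move=> x /mapP[i _ ->]; rewrite ltr0n.
Qed.

(** * Existence of the maximum and the fifth root *)

(** With no arrangement in general position, every [d] would be guaranteed vacuously. *)
Lemma guaranteed_le (R : realType) (n d : nat) : guaranteed R n d -> (d <= n)%N.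
Proof.
move=> g; have [arr no6] := cubic_arrangementP R n.
by have [S [<- _]] := g _ arr no6; rewrite -[X in (_ <= X)%N]card_ord max_card.
Qed.

(** A guaranteed value and the bound [n] yield a maximum, so [xget] returns it and not the default
    0. *)
Lemma le_D (R : realType) (n d : nat) : guaranteed R n d -> (d <= D R n)%N.
Proof.
move=> g.
have ex : exists d, `[< guaranteed R n d >] by exists d; apply/asboolP.
have ub d' : `[< guaranteed R n d' >] -> (d' <= n)%N by move=> /asboolP/guaranteed_le.
case: (ex_maxnP ex ub) => m /asboolP gm max_m.
suff [_] : is_largest (fun d' => guaranteed R n d') (D R n) by apply.
apply: (@xgetPex nat 0%N (fun d => is_largest (fun d' => guaranteed R n d') d)).
by exists m; split=> // d' gd'; apply: max_m; apply/asboolP.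
Qed.

Theorem theorem4 (R : realType) (n : nat) (hn : (2 <= n)%N) :
  (n%:R : R) `^ (5%:R^-1) < (D R n)%:R.
Proof.
have ex : exists N, (N ^ 5 <= n)%N by exists 0%N.
have ub N : (N ^ 5 <= n)%N -> (N <= n)%N.
  by move=> /(leq_trans _); apply; case: N => // N; rewrite -{1}(expn1 N.+1) leq_pexp2l.
(* [N] is the integer part of the fifth root of [n]. *)
case: (ex_maxnP ex ub) => N N5 maxN.
have N1 : (1 <= N)%N by apply: maxN; rewrite exp1n; exact: ltnW.
have nN : (n < N.+1 ^ 5)%N by rewrite ltnNge; apply/negP => /maxN; rewrite ltnn.
(* For [N = 1] this is [2 <= n]; for larger [N] already [N ^ 5] exceeds [N]. *)
have Nn : (N.+1 <= n)%N.
  have [N2|N2] := leqP N 1; first exact: leq_trans hn.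
  apply: leq_trans N5; rewrite !expnS expn0; nia.
have ND := le_D (@guaranteed_root R n N Nn N5).
apply: (@lt_le_trans _ _ (N.+1%:R)); last by rewrite ler_nat.
have -> : (N.+1%:R : R) = (N.+1%:R ^+ 5) `^ 5%:R^-1.
  by rewrite -powR_mulrn ?ler0n // -powRrM divff ?pnatr_eq0 // powRr1 ?ler0n.
apply: gt0_ltr_powR; rewrite ?invr_gt0 ?ltr0n ?nnegrE ?ler0n ?exprn_ge0 //.
by rewrite -natrX ltr_nat.
Qed.
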